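(* Let $0<|q|<1$, $0<|p|<1$, $0<|x|<1$, $0<|y|<1$, and let $r,s\ge 0$ be integers. (I) Let $a,b,c,d\in\mathbb{C}$ with $p^{c}\neq p^{-n}$ and $q^{d}\ne q^{-n}$ for all integers $n\ge 0$. Then $$\mathbb{D}_{x,q}^{r}\Psi_{1}(q^{a},p^{b};p^{c},q^{d};q,p,x,y)=\frac{(q^{a};q)_{r}}{(1-q)^{r}(q^{d};q)_{r}}\Psi_{1}(q^{a+r},p^{b};p^{c},q^{d+r};q,p,x,y),$$ $$\mathbb{D}_{y,p}^{s}\Psi_{1}(q^{a},p^{b};p^{c},q^{d};q,p,x,y)=\frac{(q^{a};q)_{s}(p^{b};p)_{s}}{(1-p)^{s}(p^{c};p)_{s}}\Psi_{1}(q^{a+s},p^{b+s};p^{c+s},q^{d};q,p,x,y),$$ $$\mathbb{D}_{x,q}^{r}\mathbb{D}_{y,p}^{s}\Psi_{1}(q^{a},p^{b};p^{c},q^{d};q,p,x,y)=\frac{(q^{a};q)_{r+s}(p^{b};p)_{s}}{(1-q)^{r}(1-p)^{s}(p^{c};p)_{s}(q^{d};q)_{r}}\Psi_{1}(q^{a+r+s},p^{b+s};p^{c+s},q^{d+r};q,p,x,y).$$ (II) Let $a,b,c\in\mathbb{C}$ with $p^{b}\neq p^{-n}$ and $q^{c}\ne q^{-n}$ for all integers $n\ge 0$. Then $$\mathbb{D}_{x,q}^{r}\Psi_{2}(q^{a};p^{b},q^{c};q,p,x,y)=\frac{(q^{a};q)_{r}}{(1-q)^{r}(q^{c};q)_{r}}\Psi_{2}(q^{a+r};p^{b},q^{c+r};q,p,x,y),$$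 $$\mathbb{D}_{y,p}^{s}\Psi_{2}(q^{a};p^{b},q^{c};q,p,x,y)=\frac{(q^{a};q)_{s}}{(1-p)^{s}(p^{b};p)_{s}}\Psi_{2}(q^{a+s};p^{b+s},q^{c};q,p,x,y),$$ $$\mathbb{D}_{x,q}^{r}\mathbb{D}_{y,p}^{s}\Psi_{2}(q^{a};p^{b},q^{c};q,p,x,y)=\frac{(q^{a};q)_{r+s}}{(1-q)^{r}(1-p)^{s}(p^{b};p)_{s}(q^{c};q)_{r}}\Psi_{2}(q^{a+r+s};p^{b+s},q^{c+r};q,p,x,y).$$
   Context: $q,p\in\mathbb{C}$ are two independent bases with $0<|q|<1$, $0<|p|<1$; logarithms of $q$ and $p$ are fixed so that $q^{a}=e^{a\log q}$, $p^{b}=e^{b\log p}$ for complex exponents. The $q$-shifted factorial is $(A;q)_{0}=1$, $(A;q)_{k}=\prod_{r=0}^{k-1}(1-Aq^{r})$ for $k\ge1$ (similarly with base $p$). The $q$-difference operator in a variable $x$ is $\mathbb{D}_{x,q}f(x)=\dfrac{f(x)-f(qx)}{(1-q)x}$, $x\ne0$ (other variables fixed); $\mathbb{D}_{y,p}$ is the analogue with variable $y$ and base $p$; powers denote iteration. The bibasic Humbert functions are, for $|x|,|y|<1$ and whenever no denominator factor vanishes, $$\Psi_{1}(q^{a},p^{b};p^{c},q^{d};q,p,x,y)=\sum_{\ell,k=0}^{\infty}\frac{(q^{a};q)_{k+\ell}(p^{b};p)_{\ell}}{(p^{c};p)_{\ell}(q^{d};q)_{k}(q;q)_{k}(p;p)_{\ell}}x^{k}y^{\ell},$$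 $$\Psi_{2}(q^{a};p^{b},q^{c};q,p,x,y)=\sum_{\ell,k=0}^{\infty}\frac{(q^{a};q)_{k+\ell}}{(p^{b};p)_{\ell}(q^{c};q)_{k}(q;q)_{k}(p;p)_{\ell}}x^{k}y^{\ell}.$$ *)

(* Defs.v *)
(* Stdlib reals with Coquelicot's complex numbers [C]. *)
From Stdlib Require Export Reals List.
From Coquelicot Require Export Coquelicot.
Export ListNotations.
Open Scope C_scope.

Definition Cexp (z : C) : C :=
  ((exp (Re z) * cos (Im z))%R, (exp (Re z) * sin (Im z))%R).

(* [cpow lq a] is q^a, where [lq] is the chosen logarithm of q
   (so [Cexp lq = q]). *)
Definition cpow (lq a : C) : C := Cexp (a * lq).

(* (A; q)_k *)
Fixpoint qpoch (A q : C) (k : nat) : C :=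
  match k with
  | O => 1
  | S j => qpoch A q j * (1 - A * q ^ j)
  end.

(* Neighbourhood filter of infinity on finite subsets of [T], ordered by
   inclusion; finite subsets are represented by duplicate-free lists. *)
Definition finite_subsets {T : Type} (P : list T -> Prop) : Prop :=
  exists L0 : list T, forall L : list T, NoDup L -> incl L0 L -> P L.

Definition finite_sum {T : Type} (u : T -> C) (L : list T) : C :=
  fold_right (fun t acc => u t + acc) 0 L.

(* Unordered (equivalently, absolutely convergent) summation. *)
Definition is_usum {T : Type} (u : T -> C) (S : C) : Prop :=
  filterlim (finite_sum u) finite_subsets (locally S).

(* The sum when it exists, an unspecified value otherwise, as for [RInt]. *)
Definition usum {T : Type} (u : T -> C) : C :=
  iota (T := C_CompleteNormedModule) (is_usum u).

(* The parameters [A], [B], [G], [D] stand for q^a, p^b, p^c, q^d. *)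
Definition Psi1_term (A B G D q p x y : C) (lk : nat * nat) : C :=
  let (l, k) := lk in
  (qpoch A q (k + l) * qpoch B p l)
  / (qpoch G p l * qpoch D q k * qpoch q q k * qpoch p p l)
  * x ^ k * y ^ l.

Definition Psi1 (A B G D q p x y : C) : C := usum (Psi1_term A B G D q p x y).

(* The parameters [A], [B], [G] stand for q^a, p^b, q^c. *)
Definition Psi2_term (A B G q p x y : C) (lk : nat * nat) : C :=
  let (l, k) := lk in
  qpoch A q (k + l)
  / (qpoch B p l * qpoch G q k * qpoch q q k * qpoch p p l)
  * x ^ k * y ^ l.

Definition Psi2 (A B G q p x y : C) : C := usum (Psi2_term A B G q p x y).

(* q-difference operators in the first and in the second variable. *)
Definition Dx (q : C) (f : C -> C -> C) (x y : C) : C :=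
  (f x y - f (q * x) y) / ((1 - q) * x).

Definition Dy (p : C) (f : C -> C -> C) (x y : C) : C :=
  (f x y - f x (p * y)) / ((1 - p) * y).

(* Main.v *)
(* Since q^n and p^n tend to 0, each shifted factorial and each reciprocal
   is bounded by an absolutely convergent infinite product, so both Humbert
   series are double power series with bounded coefficients.  On such a
   series D_{x,q} acts termwise, x^k going to (1-q^k)/(1-q) x^(k-1), and the
   new coefficients are again bounded.  Iterating multiplies the shifted
   coefficients by (q;q)_(r+k)/((q;q)_k (1-q)^r), and the formulas follow by
   comparing coefficients with (A;q)_(m+n) = (A;q)_m (A q^m;q)_n. *)
Require Import Defs.
From Stdlib Require Import Permutation Lia Lra Classical FunctionalExtensionality.

(** * Unordered sums along the filter of finite subsets *)

Lemma NoDup_incl_Permutation {T : Type} (L L' : list T) :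
  NoDup L -> incl L L' -> exists M, Permutation L' (L ++ M).
Proof.
  intros HL; revert L'; induction HL as [|t L Ht HL IH]; intros L' Hi.
  - exists L'; reflexivity.
  - destruct (in_split t L') as (L1 & L2 & ->); [apply Hi; now left|].
    (* The head [t] is cut out of the larger list; the tail stays included because [t] does not
       occur in it. *)
    destruct (IH (L1 ++ L2)) as [M HM].
    + intros u Hu; assert (Hu' := Hi u (or_intror Hu)).
      apply in_app_or in Hu'; apply in_or_app; destruct Hu' as [|[->|]]; tauto.
    + exists M; simpl; rewrite <- HM; symmetry; apply Permutation_middle.
Qed.

(** Every finite list lies inside a duplicate-free one, so no member of the filter is empty.
    Properness is what makes limits along it unique. *)
#[local] Instance finite_subsets_proper {T : Type} :
  ProperFilter (@finite_subsets T).
Proof.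
  assert (Hnd : forall L : list T, exists L', NoDup L' /\ incl L L').
  { induction L as [|t L (L' & HL' & Hi)].
    - exists nil; split; [constructor | easy].
    - destruct (classic (In t L')) as [Ht|Ht].
      + exists L'; split; auto; intros u [<-|Hu]; auto.
      + exists (t :: L'); split; [now constructor|].
        intros u [<-|Hu]; [now left | right; auto]. }
  constructor; [|constructor].
  - intros P [L0 H0]; destruct (Hnd L0) as (L & HL & Hi); exists L; auto.
  - exists nil; auto.
  - intros P Q [L1 H1] [L2 H2]; exists (L1 ++ L2); intros L HL Hi; split;
      [apply H1 | apply H2]; auto; intros t Ht; apply Hi, in_or_app; auto.
  - intros P Q HPQ [L0 H0]; exists L0; auto.
Qed.

(** Uniqueness of limits forces [iota] to return [S]; convergence statements thereby become
    equations between sums. *)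
Lemma usum_unique {T : Type} (u : T -> C) (S : C) : is_usum u S -> usum u = S.
Proof.
  intros H; unfold usum, is_usum.
  apply (iota_filterlim_locally (V := C_CompleteNormedModule)
    (FF := Proper_StrongProper _ finite_subsets_proper)); exact H.
Qed.

Lemma finite_sum_app {T : Type} (u : T -> C) (L M : list T) :
  finite_sum u (L ++ M) = finite_sum u L + finite_sum u M.
Proof.
  induction L as [|t L IH]; simpl; [ring | rewrite IH; ring].
Qed.

Lemma finite_sum_Permutation {T : Type} (u : T -> C) (L M : list T) :
  Permutation L M -> finite_sum u L = finite_sum u M.
Proof.
  induction 1; simpl; try congruence; ring.
Qed.

Lemma is_usum_scal {T : Type} (K : C) (u : T -> C) (S : C) :
  is_usum u S -> is_usum (fun t => K * u t) (K * S).
Proof.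
  intros H; unfold is_usum.
  apply filterlim_ext with (f := fun L => K * finite_sum u L).
  - induction x as [|t L IH]; simpl; [ring | rewrite <- IH; ring].
  - eapply filterlim_comp; [exact H|].
    exact (filterlim_scal_r (V := C_NormedModule) K S).
Qed.

Lemma is_usum_plus {T : Type} (u v : T -> C) (S S' : C) :
  is_usum u S -> is_usum v S' -> is_usum (fun t => u t + v t) (S + S').
Proof.
  intros H H'; unfold is_usum.
  apply filterlim_ext with (f := fun L => finite_sum u L + finite_sum v L).
  - induction x as [|t L IH]; simpl; [ring | rewrite <- IH; ring].
  - eapply (filterlim_comp_2 (H := locally S')); [exact H | exact H' |].
    exact (filterlim_plus (V := C_NormedModule) S S').
Qed.

Lemma is_usum_ext {T : Type} (u v : T -> C) (S : C) :
  (forall t, u t = v t) -> is_usum u S -> is_usum v S.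
Proof.
  intros E; apply filterlim_ext; intros L.
  induction L as [|t L IH]; simpl; [|rewrite E, IH]; reflexivity.
Qed.

(** Terms outside the range of [phi] vanish, so a finite sum of [u] equals the sum over the preimage
    of its index set. This permits the index shift k -> k+1 once the terms with k = 0 have
    cancelled. *)
Lemma is_usum_reindex {T T' : Type} (phi : T' -> T) (u : T -> C) (S : C) :
  (forall s t, phi s = phi t -> s = t) ->
  (forall t, u t <> 0 -> exists t', t = phi t') ->
  is_usum (fun t => u (phi t)) S -> is_usum u S.
Proof.
  intros Hinj Hsupp H P HP; destruct (H P HP) as [L0 H0].
  exists (map phi L0); intros L HL Hi.
  (* [L'] is the preimage of [L], built entry by entry; injectivity gives each entry at most one
     preimage. *)
  assert (Hpre : exists L', NoDup L' /\ (forall t, In (phi t) L <-> In t L') /\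
            finite_sum u L = finite_sum (fun t => u (phi t)) L').
  { clear Hi; induction HL as [|t L Ht HL (L' & HL' & Hin & E)].
    - exists nil; split; [constructor | split; [simpl; tauto | reflexivity]].
    - destruct (classic (exists t', t = phi t')) as [[t' ->]|Hno].
      + exists (t' :: L'); split; [|split].
        * constructor; auto; now rewrite <- Hin.
        * intros s; simpl; rewrite Hin; split; intros [Hs|Hs]; auto.
          left; congruence.
        * simpl; now rewrite E.
      + exists L'; split; [|split]; auto.
        * intros s; simpl; rewrite Hin; split; auto; intros [Hs|Hs]; auto.
          destruct Hno; now exists s.
        * simpl; rewrite E; destruct (classic (u t = 0)) as [->|Hu]; [ring|].
          destruct Hno; auto. }
  destruct Hpre as (L' & HL' & Hin & E); rewrite E; apply H0; auto.
  intros t Ht; apply Hin, Hi, in_map, Ht.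
Qed.

(** * Absolute summability *)

Definition abs_sum {T : Type} (u : T -> C) (L : list T) : R :=
  fold_right (fun t acc => (Cmod (u t) + acc)%R) 0%R L.

Lemma abs_sum_app {T : Type} (u : T -> C) (L M : list T) :
  (abs_sum u (L ++ M) = abs_sum u L + abs_sum u M)%R.
Proof.
  induction L as [|t L IH]; simpl; [ring | rewrite IH; ring].
Qed.

Lemma abs_sum_Permutation {T : Type} (u : T -> C) (L M : list T) :
  Permutation L M -> abs_sum u L = abs_sum u M.
Proof.
  induction 1; simpl; try congruence; ring.
Qed.

Lemma Cmod_finite_sum_le {T : Type} (u : T -> C) (L : list T) :
  (Cmod (finite_sum u L) <= abs_sum u L)%R.
Proof.
  induction L as [|t L IH]; simpl.
  - rewrite Cmod_0; lra.
  - eapply Rle_trans; [apply Cmod_triangle | lra].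
Qed.

Lemma abs_sum_incl {T : Type} (u : T -> C) (L L' : list T) :
  NoDup L -> incl L L' -> (abs_sum u L <= abs_sum u L')%R.
Proof.
  intros HL Hi; destruct (NoDup_incl_Permutation L L' HL Hi) as [M HM].
  rewrite (abs_sum_Permutation u _ _ HM), abs_sum_app.
  (* The two facts together show that [abs_sum u M] is nonnegative. *)
  assert (H := Cmod_finite_sum_le u M).
  assert (H' := Cmod_ge_0 (finite_sum u M)); lra.
Qed.

(** Cauchy criterion: let [S] be the supremum of the absolute sums and [L0] a list within eps/2 of
    it. Enlarging [L0] adds terms of absolute sum below eps/2, so any two larger lists have sums
    within eps of each other. *)
Lemma summable_of_bounded {T : Type} (u : T -> C) (K : R) :
  (forall L, NoDup L -> (abs_sum u L <= K)%R) -> exists S, is_usum u S.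
Proof.
  intros HK.
  destruct (completeness (fun s => exists L, NoDup L /\ s = abs_sum u L))
    as [S [Hub Hlub]].
  - exists K; intros s (L & HL & ->); auto.
  - exists 0%R, nil; split; [constructor | reflexivity].
  - apply (filterlim_locally_cauchy (U := C_CompleteNormedModule)
      (finite_sum u)).
    intros eps.
    assert (Hex : exists L0, NoDup L0 /\ (S - eps / 2 < abs_sum u L0)%R).
    { apply NNPP; intros Hno.
      assert (S <= S - eps / 2)%R; [|destruct eps; simpl in *; lra].
      apply Hlub; intros s (L & HL & ->); apply Rnot_lt_le; intros Hlt.
      apply Hno; eauto. }
    destruct Hex as (L0 & HL0 & HS).
    assert (Hclose : forall L, NoDup L -> incl L0 L ->
              (Cmod (finite_sum u L - finite_sum u L0) < eps / 2)%R).
    { intros L HL Hi; destruct (NoDup_incl_Permutation L0 L HL0 Hi) as [M HM].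
      rewrite (finite_sum_Permutation u _ _ HM), finite_sum_app.
      replace (_ - _) with (finite_sum u M) by ring.
      eapply Rle_lt_trans; [apply Cmod_finite_sum_le|].
      assert (abs_sum u L <= S)%R by (apply Hub; eauto).
      rewrite (abs_sum_Permutation u _ _ HM), abs_sum_app in H; lra. }
    exists (fun L => NoDup L /\ incl L0 L); split.
    + exists L0; auto.
    (* Balls of the uniform structure are coordinatewise; a bound on the modulus is enough to enter
       one. *)
    + intros L M [HL HiL] [HM HiM]; apply C_NormedModule_mixin_compat1.
      change (minus ?a ?b) with (a - b).
      replace (finite_sum u M - finite_sum u L) with
        ((finite_sum u M - finite_sum u L0)
         + - (finite_sum u L - finite_sum u L0)) by ring.
      eapply Rle_lt_trans; [apply Cmod_triangle|]; rewrite Cmod_opp.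
      assert (H1 := Hclose L HL HiL); assert (H2 := Hclose M HM HiM); lra.
Qed.

(** * Convergence of double power series with bounded coefficients *)

Fixpoint geom (z : R) (n : nat) : R :=
  match n with O => 0 | S m => geom z m + z ^ m end.

(** The bound is uniform in [n]; it controls the double series below and also the infinite products
    later. *)
Lemma geom_bound (z : R) (n : nat) :
  (0 <= z < 1 -> 0 <= geom z n <= / (1 - z))%R.
Proof.
  intros Hz.
  assert (E : (geom z n * (1 - z) = 1 - z ^ n)%R).
  { induction n as [|n IH]; simpl; [ring | rewrite Rmult_plus_distr_r, IH; ring]. }
  assert (Hp : (0 <= z ^ n)%R) by (apply pow_le; lra).
  split.
  - clear E Hp; induction n as [|n IH]; simpl; [lra|].
    assert (0 <= z ^ n)%R by (apply pow_le; lra); lra.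
  - apply (Rmult_le_reg_r (1 - z)); [lra|]; rewrite E, Rinv_l; lra.
Qed.

(** Every finite index set lies in a square, on which the absolute sum is at most [M] times a
    product of two geometric sums. *)
Lemma double_series_summable (c : nat -> nat -> C) (M : R) (x y : C) :
  (forall l k, (Cmod (c l k) <= M)%R) ->
  (Cmod x < 1)%R -> (Cmod y < 1)%R ->
  exists S, is_usum (fun lk : nat * nat => let (l, k) := lk in
                       c l k * x ^ k * y ^ l) S.
Proof.
  intros HM Hx Hy.
  set (u := fun lk : nat * nat => let (l, k) := lk in c l k * x ^ k * y ^ l).
  assert (Hx0 := Cmod_ge_0 x); assert (Hy0 := Cmod_ge_0 y).
  assert (HM0 : (0 <= M)%R).
  { eapply Rle_trans; [apply Cmod_ge_0 | apply (HM 0%nat 0%nat)]. }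
  assert (Hrow : forall l n, (abs_sum u (map (pair l) (seq 0 n))
                   <= M * geom (Cmod x) n * Cmod y ^ l)%R).
  { intros l n; induction n as [|n IH]; [simpl; lra|].
    rewrite seq_S, map_app, abs_sum_app; simpl.
    rewrite !Cmod_mult, !Cmod_pow.
    assert (0 <= Cmod x ^ n)%R by (apply pow_le; lra).
    assert (0 <= Cmod y ^ l)%R by (apply pow_le; lra).
    assert (Cmod (c l n) * Cmod x ^ n * Cmod y ^ l
            <= M * Cmod x ^ n * Cmod y ^ l)%R.
    { apply Rmult_le_compat_r; auto; apply Rmult_le_compat_r; auto. }
    lra. }
  assert (Hsq : forall m n, (abs_sum u (list_prod (seq 0 m) (seq 0 n))
                  <= M * geom (Cmod x) n * geom (Cmod y) m)%R).
  { intros m n; induction m as [|m IH]; [simpl; lra|].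
    rewrite seq_S, !list_prod_as_flat_map, flat_map_app, abs_sum_app; simpl.
    rewrite <- list_prod_as_flat_map.
    rewrite app_nil_r; specialize (Hrow m n); lra. }
  apply (summable_of_bounded u (M * / (1 - Cmod x) * / (1 - Cmod y))).
  intros L HL.
  assert (HN : exists N, incl L (list_prod (seq 0 N) (seq 0 N))).
  { clear HL; induction L as [|[l k] L [N HN]]; [exists 0%nat; easy|].
    exists (S (N + l + k)); intros [l' k'] Hin; apply in_prod_iff.
    rewrite !in_seq.
    destruct Hin as [E|Hin]; [injection E as <- <-; lia|].
    apply HN, in_prod_iff in Hin; rewrite !in_seq in Hin; lia. }
  destruct HN as [N HN].
  eapply Rle_trans; [apply (abs_sum_incl u _ _ HL HN)|].
  eapply Rle_trans; [apply Hsq|].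
  destruct (geom_bound (Cmod x) N) as [? ?]; [lra|].
  destruct (geom_bound (Cmod y) N) as [? ?]; [lra|].
  apply Rmult_le_compat; auto; [apply Rmult_le_pos; auto|].
  apply Rmult_le_compat_l; auto.
Qed.

(** * Uniform bounds for shifted factorials and their reciprocals *)

(** The inequality 1 + t <= exp t turns the product into the exponential of a geometric sum. Only
    growth from one index to the next is constrained, so factorials and reciprocals are both
    covered. *)
Lemma prod_bound (f : nat -> R) (K z : R) :
  (0 <= z < 1)%R -> (0 <= K)%R ->
  f 0%nat = 1%R -> (forall n, 0 <= f n)%R ->
  (forall n, f (S n) <= f n * (1 + K * z ^ n))%R ->
  forall n, (f n <= exp (K * / (1 - z)))%R.
Proof.
  intros Hz HK H0 Hpos HS n.
  assert (Hg : forall m, (f m <= exp (K * geom z m))%R).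
  { induction m as [|m IH]; simpl.
    - rewrite H0, Rmult_0_r, exp_0; lra.
    - rewrite Rmult_plus_distr_l, exp_plus.
      assert (0 <= z ^ m)%R by (apply pow_le; lra).
      eapply Rle_trans; [apply HS|].
      apply Rmult_le_compat; auto; [nra|].
      apply exp_ineq1_le. }
  eapply Rle_trans; [apply Hg|].
  apply Rnot_lt_le; intros Hlt; apply exp_lt_inv in Hlt.
  apply Rlt_not_le in Hlt; apply Hlt.
  apply Rmult_le_compat_l; auto; apply geom_bound, Hz.
Qed.

Lemma qpoch_bounded (A q : C) :
  (Cmod q < 1)%R -> exists M, forall n, (Cmod (qpoch A q n) <= M)%R.
Proof.
  (* The bound is left open; [prod_bound] fills it with exp(|A|/(1-|q|)). *)
  intros Hq; eexists.
  apply (prod_bound _ (Cmod A) (Cmod q)).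
  - split; [apply Cmod_ge_0 | exact Hq].
  - apply Cmod_ge_0.
  - apply Cmod_1.
  - intros n; apply Cmod_ge_0.
  - intros n; simpl; rewrite Cmod_mult; apply Rmult_le_compat_l;
      [apply Cmod_ge_0|].
    eapply Rle_trans; [apply Cmod_triangle|].
    rewrite Cmod_opp, Cmod_mult, Cmod_pow, Cmod_1; lra.
Qed.

Lemma one_minus_neq_0 (z : C) : z <> 1 -> 1 - z <> 0.
Proof.
  intros Hz H; apply Hz.
  replace z with (1 - (1 - z)) by ring; rewrite H; ring.
Qed.

Lemma qpoch_neq_0 (A q : C) (n : nat) :
  (forall j, A * q ^ j <> 1) -> qpoch A q n <> 0.
Proof.
  intros H; induction n as [|n IH]; simpl; [apply C1_nz|].
  apply Cmult_neq_0; [exact IH | apply one_minus_neq_0, H].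
Qed.

Lemma Cmod_one_minus_ge (z : C) : (1 - Cmod z <= Cmod (1 - z))%R.
Proof.
  assert (H := Cmod_triangle (1 - z) z).
  replace (1 - z + z) with (RtoC 1) in H by ring.
  rewrite Cmod_1 in H; lra.
Qed.

(** Since A q^j tends to 0, all but finitely many factors have modulus at least 1/2; the remaining
    ones are nonzero and have a positive minimum. *)
Lemma qfactors_away_from_0 (A q : C) :
  (Cmod q < 1)%R -> (forall j, A * q ^ j <> 1) ->
  exists d, (0 < d)%R /\ forall j, (d <= Cmod (1 - A * q ^ j))%R.
Proof.
  intros Hq HA.
  assert (Hq0 := Cmod_ge_0 q); assert (HA0 := Cmod_ge_0 A).
  assert (Hfin : forall N, exists d, (0 < d)%R /\
            forall j, (j < N)%nat -> (d <= Cmod (1 - A * q ^ j))%R).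
  { induction N as [|N (d & Hd & H)]; [exists 1%R; split; [lra | lia]|].
    assert (HN : (0 < Cmod (1 - A * q ^ N))%R)
      by (apply Cmod_gt_0, one_minus_neq_0, HA).
    exists (Rmin d (Cmod (1 - A * q ^ N))); split;
      [now apply Rmin_glb_lt|].
    intros j Hj; destruct (Nat.eq_dec j N) as [->|]; [apply Rmin_r|].
    eapply Rle_trans; [apply Rmin_l | apply H; lia]. }
  (* This threshold gives |A q^j| < 1/2 from [N] on; the added 1 keeps the division legitimate when
     [A] is 0. *)
  destruct (pow_lt_1_zero (Cmod q)) with (y := (/ 2 / (Cmod A + 1))%R)
    as [N HN].
  - rewrite Rabs_pos_eq; lra.
  - apply Rdiv_lt_0_compat; lra.
  - destruct (Hfin N) as (d & Hd & H).
    exists (Rmin d (/ 2)); split; [apply Rmin_glb_lt; lra|].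
    intros j; destruct (Nat.le_gt_cases N j) as [Hj|Hj].
    + eapply Rle_trans; [apply Rmin_r|].
      eapply Rle_trans; [|apply Cmod_one_minus_ge].
      rewrite Cmod_mult, Cmod_pow.
      specialize (HN j Hj); rewrite Rabs_pos_eq in HN by (apply pow_le; lra).
      apply (Rmult_lt_compat_r (Cmod A + 1)) in HN; [|lra].
      unfold Rdiv in HN; rewrite Rmult_assoc, Rinv_l in HN by lra.
      assert (0 <= Cmod q ^ j)%R by (apply pow_le; lra); lra.
    + eapply Rle_trans; [apply Rmin_l | auto].
Qed.

(** With [d] a lower bound for the factors, each step multiplies the reciprocal by at most 1 +
    (|A|/d)|q|^n in modulus, so [prod_bound] applies. *)
Lemma inv_qpoch_bounded (A q : C) :
  (Cmod q < 1)%R -> (forall j, A * q ^ j <> 1) ->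
  exists M, forall n, (Cmod (/ qpoch A q n) <= M)%R.
Proof.
  intros Hq HA.
  destruct (qfactors_away_from_0 A q Hq HA) as (d & Hd & H).
  eexists; apply (prod_bound _ (Cmod A / d) (Cmod q)).
  - split; [apply Cmod_ge_0 | exact Hq].
  - apply Rmult_le_pos; [apply Cmod_ge_0 | left; now apply Rinv_0_lt_compat].
  - simpl; replace (/ 1) with (RtoC 1) by (field; apply C1_nz); apply Cmod_1.
  - intros n; apply Cmod_ge_0.
  - intros n; simpl.
    assert (Hn := one_minus_neq_0 _ (HA n)).
    (* 1 / (1 - w) = 1 + w / (1 - w) *)
    replace (/ (qpoch A q n * (1 - A * q ^ n))) with
      (/ qpoch A q n * (1 + A * q ^ n / (1 - A * q ^ n)))
      by (field; split; [exact Hn | now apply qpoch_neq_0]).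
    rewrite Cmod_mult; apply Rmult_le_compat_l; [apply Cmod_ge_0|].
    eapply Rle_trans; [apply Cmod_triangle|]; rewrite Cmod_1.
    apply Rplus_le_compat_l.
    rewrite Cmod_div, Cmod_mult, Cmod_pow by exact Hn.
    replace (Cmod A / d * Cmod q ^ n)%R with (Cmod A * Cmod q ^ n / d)%R
      by (field; lra).
    apply Rmult_le_compat_l.
    + apply Rmult_le_pos; [|apply pow_le]; apply Cmod_ge_0.
    + apply Rinv_le_contravar; auto.
Qed.

Lemma qpoch_add (A q : C) (m n : nat) :
  qpoch A q (m + n) = qpoch A q m * qpoch (A * q ^ m) q n.
Proof.
  induction n as [|n IH]; [rewrite Nat.add_0_r; simpl; ring|].
  rewrite Nat.add_succ_r; simpl; rewrite IH, Cpow_add_r; ring.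
Qed.

(** The factors of the shifted parameter are a tail of the original ones, so the denominators on the
    right-hand sides do not vanish either. *)
Lemma qpoch_shift_factor (A q : C) (n : nat) :
  (forall j, A * q ^ j <> 1) -> forall j, A * q ^ n * q ^ j <> 1.
Proof.
  intros H j; rewrite <- Cmult_assoc, <- Cpow_add_r; apply H.
Qed.

(** * Termwise action of the difference operators *)

Definition dser (c : nat -> nat -> C) (x y : C) : C :=
  usum (fun lk : nat * nat => let (l, k) := lk in c l k * x ^ k * y ^ l).

(** The invariant of the iteration: it is preserved by [Sx] and [Sy] and gives convergence on the
    whole open bidisc, including at [q * x] and [p * y]. *)
Definition bounded2 (c : nat -> nat -> C) : Prop :=
  exists M, forall l k, (Cmod (c l k) <= M)%R.

(* [Sx] and [Sy] are the actions of [Dx] and [Dy] on coefficients. *)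
Definition Sx (q : C) (c : nat -> nat -> C) (l k : nat) : C :=
  c l (S k) * ((1 - q ^ S k) / (1 - q)).

Definition Sy (p : C) (c : nat -> nat -> C) (l k : nat) : C :=
  c (S l) k * ((1 - p ^ S l) / (1 - p)).

Lemma dser_correct (c : nat -> nat -> C) (x y : C) :
  bounded2 c -> (Cmod x < 1)%R -> (Cmod y < 1)%R ->
  is_usum (fun lk : nat * nat => let (l, k) := lk in c l k * x ^ k * y ^ l)
    (dser c x y).
Proof.
  intros [M HM] Hx Hy.
  destruct (double_series_summable c M x y HM Hx Hy) as [S HS].
  unfold dser; now rewrite (usum_unique _ _ HS).
Qed.

Lemma bounded2_mult (c d : nat -> nat -> C) :
  bounded2 c -> bounded2 d -> bounded2 (fun l k => c l k * d l k).
Proof.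
  intros [M HM] [N HN]; exists (M * N)%R; intros l k; rewrite Cmod_mult.
  apply Rmult_le_compat; auto using Cmod_ge_0.
Qed.

Lemma qnumber_bounded (q : C) :
  (Cmod q < 1)%R ->
  forall k, (Cmod ((1 - q ^ k) / (1 - q)) <= 2 * Cmod (/ (1 - q)))%R.
Proof.
  intros Hq k; unfold Cdiv; rewrite Cmod_mult.
  apply Rmult_le_compat_r; [apply Cmod_ge_0|].
  eapply Rle_trans; [apply Cmod_triangle|].
  rewrite Cmod_opp, Cmod_pow, Cmod_1.
  assert (Cmod q ^ k <= 1 ^ k)%R.
  { apply pow_incr; split; [apply Cmod_ge_0 | lra]. }
  rewrite pow1 in H; lra.
Qed.

Lemma Sx_bounded (q : C) (c : nat -> nat -> C) :
  (Cmod q < 1)%R -> bounded2 c -> bounded2 (Sx q c).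
Proof.
  intros Hq [M HM]; apply bounded2_mult; [exists M; auto|].
  eexists; intros _ k; apply qnumber_bounded, Hq.
Qed.

Lemma Sy_bounded (p : C) (c : nat -> nat -> C) :
  (Cmod p < 1)%R -> bounded2 c -> bounded2 (Sy p c).
Proof.
  intros Hp [M HM]; apply bounded2_mult; [exists M; auto|].
  eexists; intros l _; apply qnumber_bounded, Hp.
Qed.

Lemma dser_scal (K : C) (c : nat -> nat -> C) (x y : C) :
  bounded2 c -> (Cmod x < 1)%R -> (Cmod y < 1)%R ->
  dser (fun l k => K * c l k) x y = K * dser c x y.
Proof.
  intros Hc Hx Hy; apply usum_unique.
  apply is_usum_ext with
    (2 := is_usum_scal K _ _ (dser_correct c x y Hc Hx Hy)).
  intros [l k]; ring.
Qed.

(** Equal families have equal sums even where the value is unspecified, so no convergence has to be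
    checked. *)
Lemma usum_ext {T : Type} (u v : T -> C) :
  (forall t, u t = v t) -> usum u = usum v.
Proof.
  intros E; f_equal; now apply functional_extensionality.
Qed.

(** The condition common to [q], [p], [x] and [y]. It is stable under products, so the operators
    stay inside their domain, and it excludes 0, by which they could not divide. *)
Definition punctured_disc (z : C) : Prop := (0 < Cmod z < 1)%R.

Lemma punctured_disc_mult (z w : C) :
  punctured_disc z -> punctured_disc w -> punctured_disc (z * w).
Proof.
  unfold punctured_disc; rewrite Cmod_mult; intros; nra.
Qed.

Lemma punctured_disc_neq_0 (z : C) : punctured_disc z -> z <> 0.
Proof.
  intros [H _]; now apply Cmod_gt_0.
Qed.

Lemma punctured_disc_neq_1 (z : C) : punctured_disc z -> z <> 1.
Proof.
  intros [_ H] ->; rewrite Cmod_1 in H; lra.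
Qed.

(** In f(x) - f(qx) the term of index k acquires the factor 1 - q^k. The terms with k = 0 cancel,
    and shifting the others by one releases a factor x. *)
Lemma Dx_dser (q : C) (c : nat -> nat -> C) (x y : C) :
  bounded2 c -> punctured_disc q -> punctured_disc x -> punctured_disc y ->
  Dx q (dser c) x y = dser (Sx q c) x y.
Proof.
  intros Hc Hq Hx Hy.
  assert (Hqx := punctured_disc_mult q x Hq Hx).
  assert (Hx0 := punctured_disc_neq_0 x Hx).
  assert (Hq1 := one_minus_neq_0 q (punctured_disc_neq_1 q Hq)).
  assert (H1 := dser_correct c x y Hc (proj2 Hx) (proj2 Hy)).
  assert (H2 := dser_correct c (q * x) y Hc (proj2 Hqx) (proj2 Hy)).
  assert (H3 := dser_correct (Sx q c) x y
                  (Sx_bounded q c (proj2 Hq) Hc) (proj2 Hx) (proj2 Hy)).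
  assert (E : dser c x y + - (1) * dser c (q * x) y
              = (1 - q) * x * dser (Sx q c) x y).
  { erewrite <- (usum_unique _ _ (is_usum_plus _ _ _ _ H1 (is_usum_scal _ _ _ H2))).
    apply usum_unique.
    apply (is_usum_reindex (fun lk : nat * nat => let (l, k) := lk in (l, S k))).
    - intros [l k] [l' k'] [= -> ->]; reflexivity.
    (* An index with k = 0 has no preimage under the shift, but its term is zero. *)
    - intros [l [|k]] H; [|now exists (l, k)].
      destruct H; simpl; ring.
    - apply is_usum_ext with (2 := is_usum_scal ((1 - q) * x) _ _ H3).
      intros [l k]; unfold Sx; rewrite Cpow_mult_l, !Cpow_S.
      field; exact Hq1. }
  unfold Dx; replace (dser c x y - dser c (q * x) y)
    with (dser c x y + - (1) * dser c (q * x) y) by ring.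
  rewrite E; field; auto.
Qed.

Lemma Dy_dser (p : C) (c : nat -> nat -> C) (x y : C) :
  bounded2 c -> punctured_disc p -> punctured_disc x -> punctured_disc y ->
  Dy p (dser c) x y = dser (Sy p c) x y.
Proof.
  intros Hc Hp Hx Hy.
  assert (Hpy := punctured_disc_mult p y Hp Hy).
  assert (Hy0 := punctured_disc_neq_0 y Hy).
  assert (Hp1 := one_minus_neq_0 p (punctured_disc_neq_1 p Hp)).
  assert (H1 := dser_correct c x y Hc (proj2 Hx) (proj2 Hy)).
  assert (H2 := dser_correct c x (p * y) Hc (proj2 Hx) (proj2 Hpy)).
  assert (H3 := dser_correct (Sy p c) x y
                  (Sy_bounded p c (proj2 Hp) Hc) (proj2 Hx) (proj2 Hy)).
  assert (E : dser c x y + - (1) * dser c x (p * y)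
              = (1 - p) * y * dser (Sy p c) x y).
  { erewrite <- (usum_unique _ _ (is_usum_plus _ _ _ _ H1 (is_usum_scal _ _ _ H2))).
    apply usum_unique.
    apply (is_usum_reindex (fun lk : nat * nat => let (l, k) := lk in (S l, k))).
    - intros [l k] [l' k'] [= -> ->]; reflexivity.
    - intros [[|l] k] H; [|now exists (l, k)].
      destruct H; simpl; ring.
    - apply is_usum_ext with (2 := is_usum_scal ((1 - p) * y) _ _ H3).
      intros [l k]; unfold Sy; rewrite Cpow_mult_l, !Cpow_S.
      field; exact Hp1. }
  unfold Dy; replace (dser c x y - dser c x (p * y))
    with (dser c x y + - (1) * dser c x (p * y)) by ring.
  rewrite E; field; auto.
Qed.

(** Agreement of [f] with the series is asked only on the punctured bidisc, so [f] may itself be an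
    iterate of [Dy], whose expansion is known only there. *)
Lemma iter_Dx_dser (q : C) (c : nat -> nat -> C) (f : C -> C -> C) (r : nat) :
  bounded2 c -> punctured_disc q ->
  (forall x y, punctured_disc x -> punctured_disc y -> f x y = dser c x y) ->
  bounded2 (Nat.iter r (Sx q) c) /\
  forall x y, punctured_disc x -> punctured_disc y ->
    Nat.iter r (Dx q) f x y = dser (Nat.iter r (Sx q) c) x y.
Proof.
  intros Hc Hq Hf; induction r as [|r [IHb IH]]; [now split|]; simpl; split.
  - apply Sx_bounded; [apply Hq | exact IHb].
  - intros x y Hx Hy; rewrite <- Dx_dser by assumption.
    unfold Dx; rewrite !IH by auto using punctured_disc_mult; reflexivity.
Qed.

Lemma iter_Dy_dser (p : C) (c : nat -> nat -> C) (f : C -> C -> C) (s : nat) :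
  bounded2 c -> punctured_disc p ->
  (forall x y, punctured_disc x -> punctured_disc y -> f x y = dser c x y) ->
  bounded2 (Nat.iter s (Sy p) c) /\
  forall x y, punctured_disc x -> punctured_disc y ->
    Nat.iter s (Dy p) f x y = dser (Nat.iter s (Sy p) c) x y.
Proof.
  intros Hc Hp Hf; induction s as [|s [IHb IH]]; [now split|]; simpl; split.
  - apply Sy_bounded; [apply Hp | exact IHb].
  - intros x y Hx Hy; rewrite <- Dy_dser by assumption.
    unfold Dy; rewrite !IH by auto using punctured_disc_mult; reflexivity.
Qed.

(** * Iterated operators on coefficients of Humbert type *)

Lemma base_qpoch_factor (q : C) (j : nat) : punctured_disc q -> q * q ^ j <> 1.
Proof.
  intros Hq; apply punctured_disc_neq_1.
  induction j as [|j IH]; simpl; [now rewrite Cmult_1_r|].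
  now apply punctured_disc_mult.
Qed.

(** The accumulated factors 1 - q^j, for j from k+1 to k+r, multiply to the quotient of two
    factorials. *)
Lemma iter_Sx (q : C) (c : nat -> nat -> C) (r l k : nat) :
  punctured_disc q ->
  Nat.iter r (Sx q) c l k
  = c l (r + k)%nat * (qpoch q q (r + k) / qpoch q q k) / (1 - q) ^ r.
Proof.
  intros Hq.
  assert (Hq1 := one_minus_neq_0 q (punctured_disc_neq_1 q Hq)).
  assert (Hqp : forall n, qpoch q q n <> 0)
    by (intros n; apply qpoch_neq_0; intros j; now apply base_qpoch_factor).
  (* The outermost [Sx] reads the coefficient at [S k], so [k] must stay free in the induction. *)
  revert k; induction r as [|r IH]; intros k.
  - simpl; field; apply Hqp.
  - change (Nat.iter (S r) (Sx q) c l k) with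
      (Nat.iter r (Sx q) c l (S k) * ((1 - q ^ S k) / (1 - q))).
    rewrite IH, Nat.add_succ_r, !Cpow_S; change (S r + k)%nat with (S (r + k)).
    change (qpoch q q (S k)) with (qpoch q q k * (1 - q * q ^ k)).
    field; repeat split; auto using Cpow_nz.
    now apply one_minus_neq_0, base_qpoch_factor.
Qed.

Lemma iter_Sy (p : C) (c : nat -> nat -> C) (s l k : nat) :
  punctured_disc p ->
  Nat.iter s (Sy p) c l k
  = c (s + l)%nat k * (qpoch p p (s + l) / qpoch p p l) / (1 - p) ^ s.
Proof.
  intros Hp.
  assert (Hp1 := one_minus_neq_0 p (punctured_disc_neq_1 p Hp)).
  assert (Hpp : forall n, qpoch p p n <> 0)
    by (intros n; apply qpoch_neq_0; intros j; now apply base_qpoch_factor).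
  revert l; induction s as [|s IH]; intros l.
  - simpl; field; apply Hpp.
  - change (Nat.iter (S s) (Sy p) c l k) with
      (Nat.iter s (Sy p) c (S l) k * ((1 - p ^ S l) / (1 - p))).
    rewrite IH, Nat.add_succ_r, !Cpow_S; change (S s + l)%nat with (S (s + l)).
    change (qpoch p p (S l)) with (qpoch p p l * (1 - p * p ^ l)).
    field; repeat split; auto using Cpow_nz.
    now apply one_minus_neq_0, base_qpoch_factor.
Qed.

(* Psi1 and Psi2 are the cases w l = (B;p)_l / (G;p)_l and w l = 1 / (B;p)_l. *)
Definition humbert_coef (A D q p : C) (w : nat -> C) (l k : nat) : C :=
  qpoch A q (k + l) * w l / (qpoch D q k * qpoch q q k * qpoch p p l).

(** One shifted factorial, [w] and three reciprocals are bounded separately; [w] is the place where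
    the two series differ. *)
Lemma humbert_coef_bounded (A D q p : C) (w : nat -> C) :
  punctured_disc q -> punctured_disc p -> (forall j, D * q ^ j <> 1) ->
  (exists M, forall l, (Cmod (w l) <= M)%R) ->
  bounded2 (humbert_coef A D q p w).
Proof.
  intros Hq Hp HD [M HM].
  destruct (qpoch_bounded A q (proj2 Hq)) as [MA HA].
  destruct (inv_qpoch_bounded D q (proj2 Hq) HD) as [MD HD'].
  destruct (inv_qpoch_bounded q q (proj2 Hq)) as [Mq Hq'];
    [intros; now apply base_qpoch_factor|].
  destruct (inv_qpoch_bounded p p (proj2 Hp)) as [Mp Hp'];
    [intros; now apply base_qpoch_factor|].
  exists (MA * M * (MD * Mq * Mp))%R; intros l k; unfold humbert_coef.
  replace (_ / _) with (qpoch A q (k + l) * w l *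
    (/ qpoch D q k * / qpoch q q k * / qpoch p p l)).
  - rewrite !Cmod_mult.
    repeat apply Rmult_le_compat; auto using Cmod_ge_0, Rmult_le_pos.
  - field; repeat split; apply qpoch_neq_0; auto;
      intros; now apply base_qpoch_factor.
Qed.

(** The common source of all six formulas. The factors (q;q)_(r+k) and (p;p)_(s+l) produced by the
    iteration cancel those of the coefficient, while [K] collects what the shift by [s] extracts
    from [w]. *)
Lemma iter_DxDy_humbert (A D q p K : C) (w w' : nat -> C) (f : C -> C -> C)
  (r s : nat) (x y : C) :
  punctured_disc q -> punctured_disc p ->
  punctured_disc x -> punctured_disc y ->
  (forall j, D * q ^ j <> 1) ->
  (exists M, forall l, (Cmod (w l) <= M)%R) ->
  (exists M, forall l, (Cmod (w' l) <= M)%R) ->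
  (forall l, w (s + l)%nat = K * w' l) ->
  (forall x y, f x y = dser (humbert_coef A D q p w) x y) ->
  Nat.iter r (Dx q) (Nat.iter s (Dy p) f) x y
  = qpoch A q (r + s) * K / ((1 - q) ^ r * (1 - p) ^ s * qpoch D q r)
    * dser (humbert_coef (A * q ^ (r + s)) (D * q ^ r) q p w') x y.
Proof.
  intros Hq Hp Hx Hy HD Hw Hw' HK Hf.
  assert (HD' := qpoch_shift_factor D q r HD).
  assert (Hc := humbert_coef_bounded A D q p w Hq Hp HD Hw).
  destruct (iter_Dy_dser p _ f s Hc Hp) as [Hb1 H1]; [auto|].
  destruct (iter_Dx_dser q _ _ r Hb1 Hq H1) as [Hb2 H2].
  rewrite H2 by assumption.
  (* With the constant inside the series, both sides can be compared coefficient by coefficient. *)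
  rewrite <- dser_scal by
    (try apply Hx; try apply Hy; now apply humbert_coef_bounded).
  apply usum_ext; intros [l k]; do 2 f_equal; rewrite iter_Sx, iter_Sy by assumption; unfold humbert_coef.
  (* This grouping lets [qpoch_add] split (A;q) at r + s. *)
  replace (r + k + (s + l))%nat with (r + s + (k + l))%nat by lia.
  rewrite HK, (qpoch_add A), (qpoch_add D).
  assert (Hqp : forall n, qpoch q q n <> 0)
    by (intros n; apply qpoch_neq_0; intros j; now apply base_qpoch_factor).
  assert (Hpp : forall n, qpoch p p n <> 0)
    by (intros n; apply qpoch_neq_0; intros j; now apply base_qpoch_factor).
  field; repeat split; auto using Cpow_nz, qpoch_neq_0, one_minus_neq_0,
    punctured_disc_neq_1.
Qed.

(** * Mixed difference formulas for the two Humbert series *)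

Lemma Psi1_dser (A B G D q p : C) :
  punctured_disc q -> punctured_disc p ->
  (forall j, G * p ^ j <> 1) -> (forall j, D * q ^ j <> 1) ->
  forall x y, Psi1 A B G D q p x y
  = dser (humbert_coef A D q p (fun l => qpoch B p l / qpoch G p l)) x y.
Proof.
  intros Hq Hp HG HD x y; apply usum_ext; intros [l k].
  unfold Psi1_term, humbert_coef; do 2 f_equal.
  field; repeat split; apply qpoch_neq_0; auto;
    intros; now apply base_qpoch_factor.
Qed.

Lemma Psi2_dser (A B G q p : C) :
  punctured_disc q -> punctured_disc p ->
  (forall j, B * p ^ j <> 1) -> (forall j, G * q ^ j <> 1) ->
  forall x y, Psi2 A B G q p x y
  = dser (humbert_coef A G q p (fun l => / qpoch B p l)) x y.
Proof.
  intros Hq Hp HB HG x y; apply usum_ext; intros [l k].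
  unfold Psi2_term, humbert_coef; do 2 f_equal.
  field; repeat split; apply qpoch_neq_0; auto;
    intros; now apply base_qpoch_factor.
Qed.

Lemma iter_DxDy_Psi1 (A B G D q p : C) (r s : nat) (x y : C) :
  punctured_disc q -> punctured_disc p ->
  punctured_disc x -> punctured_disc y ->
  (forall j, G * p ^ j <> 1) -> (forall j, D * q ^ j <> 1) ->
  Nat.iter r (Dx q) (Nat.iter s (Dy p) (Psi1 A B G D q p)) x y
  = (qpoch A q (r + s) * qpoch B p s)
    / ((1 - q) ^ r * (1 - p) ^ s * qpoch G p s * qpoch D q r)
    * Psi1 (A * q ^ (r + s)) (B * p ^ s) (G * p ^ s) (D * q ^ r) q p x y.
Proof.
  intros Hq Hp Hx Hy HG HD.
  assert (HG' := qpoch_shift_factor G p s HG).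
  assert (HD' := qpoch_shift_factor D q r HD).
  (* Stated for arbitrary parameters because it serves both the original and the shifted pair. *)
  assert (Hw : forall B G, (forall j, G * p ^ j <> 1) ->
    exists M, forall l, (Cmod (qpoch B p l / qpoch G p l) <= M)%R).
  { clear - Hp; intros B G HG.
    destruct (qpoch_bounded B p (proj2 Hp)) as [M HM].
    destruct (inv_qpoch_bounded G p (proj2 Hp) HG) as [N HN].
    exists (M * N)%R; intros l; unfold Cdiv; rewrite Cmod_mult.
    apply Rmult_le_compat; auto using Cmod_ge_0. }
  (* Splitting both factorials at [s] identifies this quotient as [K]. *)
  rewrite (iter_DxDy_humbert A D q p (qpoch B p s / qpoch G p s)
    (fun l => qpoch B p l / qpoch G p l)
    (fun l => qpoch (B * p ^ s) p l / qpoch (G * p ^ s) p l)); auto.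
  - rewrite <- Psi1_dser by assumption; f_equal.
    field; repeat split; auto using Cpow_nz, qpoch_neq_0, one_minus_neq_0,
      punctured_disc_neq_1.
  - intros l; rewrite !qpoch_add; field; split; now apply qpoch_neq_0.
  - now apply Psi1_dser.
Qed.

Lemma iter_DxDy_Psi2 (A B G q p : C) (r s : nat) (x y : C) :
  punctured_disc q -> punctured_disc p ->
  punctured_disc x -> punctured_disc y ->
  (forall j, B * p ^ j <> 1) -> (forall j, G * q ^ j <> 1) ->
  Nat.iter r (Dx q) (Nat.iter s (Dy p) (Psi2 A B G q p)) x y
  = qpoch A q (r + s)
    / ((1 - q) ^ r * (1 - p) ^ s * qpoch B p s * qpoch G q r)
    * Psi2 (A * q ^ (r + s)) (B * p ^ s) (G * q ^ r) q p x y.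
Proof.
  intros Hq Hp Hx Hy HB HG.
  assert (HB' := qpoch_shift_factor B p s HB).
  assert (HG' := qpoch_shift_factor G q r HG).
  rewrite (iter_DxDy_humbert A G q p (/ qpoch B p s)
    (fun l => / qpoch B p l) (fun l => / qpoch (B * p ^ s) p l)); auto.
  - rewrite <- Psi2_dser by assumption; f_equal.
    field; repeat split; auto using Cpow_nz, qpoch_neq_0, one_minus_neq_0,
      punctured_disc_neq_1.
  - apply inv_qpoch_bounded; [apply Hp | exact HB].
  - apply inv_qpoch_bounded; [apply Hp | exact HB'].
  - intros l; rewrite !qpoch_add; field; split; now apply qpoch_neq_0.
  - now apply Psi2_dser.
Qed.

(** * Complex exponents and specialization of the mixed formulas *)

Lemma Cexp_plus (z w : C) : Cexp (z + w) = Cexp z * Cexp w.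
Proof.
  destruct z as [a b], w as [c d]; unfold Cexp, Cmult; simpl.
  rewrite exp_plus, cos_plus, sin_plus; f_equal; ring.
Qed.

Lemma cpow_plus_INR (lq a : C) (n : nat) :
  cpow lq (a + INR n) = cpow lq a * Cexp lq ^ n.
Proof.
  unfold cpow; induction n as [|n IH].
  - simpl; rewrite Cmult_1_r; f_equal; ring.
  - rewrite S_INR, RtoC_plus, Cpow_S.
    replace ((a + (INR n + 1)) * lq) with ((a + INR n) * lq + lq) by ring.
    rewrite Cexp_plus, IH; ring.
Qed.

(** Translates the exclusion of the values q^(-n) into nonvanishing of the factors 1 - A q^n. *)
Lemma mult_pow_neq_1 (A q : C) (n : nat) :
  q <> 0 -> A <> / q ^ n -> A * q ^ n <> 1.
Proof.
  intros Hq HA H; apply HA.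
  assert (Hn := Cpow_nz q n Hq).
  replace A with (A * q ^ n / q ^ n) by (field; exact Hn).
  rewrite H; unfold Cdiv; ring.
Qed.

Theorem theorem2p4 :
  forall (q p lq lp x y : C) (r s : nat),
  (0 < Cmod q < 1)%R -> (0 < Cmod p < 1)%R ->
  Cexp lq = q -> Cexp lp = p ->
  (0 < Cmod x < 1)%R -> (0 < Cmod y < 1)%R ->
  (forall a b c d : C,
     (forall n : nat, cpow lp c <> / p ^ n) ->
     (forall n : nat, cpow lq d <> / q ^ n) ->
     Nat.iter r (Dx q)
       (Psi1 (cpow lq a) (cpow lp b) (cpow lp c) (cpow lq d) q p) x y
     = qpoch (cpow lq a) q r / ((1 - q) ^ r * qpoch (cpow lq d) q r)
       * Psi1 (cpow lq (a + INR r)) (cpow lp b)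
              (cpow lp c) (cpow lq (d + INR r)) q p x y
     /\
     Nat.iter s (Dy p)
       (Psi1 (cpow lq a) (cpow lp b) (cpow lp c) (cpow lq d) q p) x y
     = (qpoch (cpow lq a) q s * qpoch (cpow lp b) p s)
       / ((1 - p) ^ s * qpoch (cpow lp c) p s)
       * Psi1 (cpow lq (a + INR s)) (cpow lp (b + INR s))
              (cpow lp (c + INR s)) (cpow lq d) q p x y
     /\
     Nat.iter r (Dx q) (Nat.iter s (Dy p)
       (Psi1 (cpow lq a) (cpow lp b) (cpow lp c) (cpow lq d) q p)) x y
     = (qpoch (cpow lq a) q (r + s) * qpoch (cpow lp b) p s)
       / ((1 - q) ^ r * (1 - p) ^ s
          * qpoch (cpow lp c) p s * qpoch (cpow lq d) q r)
       * Psi1 (cpow lq (a + INR r + INR s)) (cpow lp (b + INR s))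
              (cpow lp (c + INR s)) (cpow lq (d + INR r)) q p x y)
  /\
  (forall a b c : C,
     (forall n : nat, cpow lp b <> / p ^ n) ->
     (forall n : nat, cpow lq c <> / q ^ n) ->
     Nat.iter r (Dx q)
       (Psi2 (cpow lq a) (cpow lp b) (cpow lq c) q p) x y
     = qpoch (cpow lq a) q r / ((1 - q) ^ r * qpoch (cpow lq c) q r)
       * Psi2 (cpow lq (a + INR r)) (cpow lp b) (cpow lq (c + INR r)) q p x y
     /\
     Nat.iter s (Dy p)
       (Psi2 (cpow lq a) (cpow lp b) (cpow lq c) q p) x y
     = qpoch (cpow lq a) q s / ((1 - p) ^ s * qpoch (cpow lp b) p s)
       * Psi2 (cpow lq (a + INR s)) (cpow lp (b + INR s)) (cpow lq c) q p x y
     /\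
     Nat.iter r (Dx q) (Nat.iter s (Dy p)
       (Psi2 (cpow lq a) (cpow lp b) (cpow lq c) q p)) x y
     = qpoch (cpow lq a) q (r + s)
       / ((1 - q) ^ r * (1 - p) ^ s
          * qpoch (cpow lp b) p s * qpoch (cpow lq c) q r)
       * Psi2 (cpow lq (a + INR r + INR s)) (cpow lp (b + INR s))
              (cpow lq (c + INR r)) q p x y).
Proof.
  intros q p lq lp x y r s Hq Hp Elq Elp Hx Hy.
  assert (Hq0 := punctured_disc_neq_0 q Hq).
  assert (Hp0 := punctured_disc_neq_0 p Hp).
  split.
  - intros a b c d Hc Hd.
    assert (HG := fun j => mult_pow_neq_1 _ p j Hp0 (Hc j)).
    assert (HD := fun j => mult_pow_neq_1 _ q j Hq0 (Hd j)).
    assert (H := fun r s => iter_DxDy_Psi1 (cpow lq a) (cpow lp b) (cpow lp c)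
      (cpow lq d) q p r s x y Hq Hp Hx Hy HG HD).
    rewrite !cpow_plus_INR, Elq, Elp.
    split; [|split].
    (* The formula in x alone is the mixed one with s = 0, where the empty products are 1; the one
       in y alone is the case r = 0. *)
    + assert (H1 := H r 0%nat); simpl in H1.
      rewrite Nat.add_0_r, !Cmult_1_r in H1; exact H1.
    + assert (H1 := H 0%nat s); simpl in H1.
      rewrite Cmult_1_l, !Cmult_1_r in H1; exact H1.
    (* Raising the exponent first by r and then by s has produced q^r and q^s separately, so q^(r+s)
       is split to match. *)
    + rewrite H, Cpow_add_r, Cmult_assoc; reflexivity.
  - intros a b c Hb Hc.
    assert (HB := fun j => mult_pow_neq_1 _ p j Hp0 (Hb j)).
    assert (HG := fun j => mult_pow_neq_1 _ q j Hq0 (Hc j)).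
    assert (H := fun r s => iter_DxDy_Psi2 (cpow lq a) (cpow lp b) (cpow lq c)
      q p r s x y Hq Hp Hx Hy HB HG).
    rewrite !cpow_plus_INR, Elq, Elp.
    split; [|split].
    + assert (H1 := H r 0%nat); simpl in H1.
      rewrite Nat.add_0_r, !Cmult_1_r in H1; exact H1.
    + assert (H1 := H 0%nat s); simpl in H1.
      rewrite Cmult_1_l, !Cmult_1_r in H1; exact H1.
    + rewrite H, Cpow_add_r, Cmult_assoc; reflexivity.
Qed.
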